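(* Let $m\ge1$, let $X_1,\dots,X_n,Y_1,\dots,Y_n$ be i.i.d. random variables with values in $\{1,\dots,m\}$ and $p_k=\mathbb{P}(X_1=k)$, and let $LC_n=LCS(X_1\cdots X_n;Y_1\cdots Y_n)$. Let $B_{2n}(2n)$ be the last term of the sequence $(B_k)_{1\le k\le 2n}$ associated with $LC_n$ viewed as a function of the $2n$ independent variables $X_1,\dots,X_n,Y_1,\dots,Y_n$. If $B_{2n}(2n)=0$, then $$\mathrm{Var}\,LC_n\le\left(1-\sum_{k=1}^mp_k^2\right)\frac n2.$$ The condition $B_{2n}(2n)=0$ is satisfied, for instance, when $p_1=\dots=p_m=1/m$.
   Context: For finite sequences $(x_1,\dots,x_s)$, $(y_1,\dots,y_t)$ with values in a finite set, $LCS(x_1\cdots x_s;y_1\cdots y_t)$ is the largest integer $k$ such that there exist $1\le i_1<\dots<i_k\le s$ and $1\le j_1<\dots<j_k\le t$ with $x_{i_1}=y_{j_1},\dots,x_{i_k}=y_{j_k}$ (and $0$ if there is no such integer). For independent $Z_1,\dots,Z_N$, an independent copy $(Z'_1,\dots,Z'_N)$ of $(Z_1,\dots,Z_N)$, and a square integrable $S=S(Z_1,\dots,Z_N)$, let $S^\alpha$ ($\alpha\subset\{1,\dots,N\}$) be $S$ with $Z_k$ replaced by $Z'_k$ for $k\in\alpha$, $S^{i_1,\dots,i_j}=S^{\{i_1,\dots,i_j\}}$, and for $1\le k\le N$ $$B_k=B_k(N):=\mathbb{E}\,\frac1{N!}\sum_{i\in\mathfrak{S}_N}S\,(S^{i_1,\dots,i_{k-1}}-S^{i_1,\dots,i_k}),$$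 where $\mathfrak{S}_N$ is the symmetric group, $i_j=i(j)$, and $S^{i_1,\dots,i_{k-1}}=S$ when $k=1$. Here $N=2n$ and $(Z_1,\dots,Z_{2n})=(X_1,\dots,X_n,Y_1,\dots,Y_n)$. *)

(* Defs.v *)
From HB Require Import structures.
From mathcomp Require Import all_boot all_order all_fingroup all_algebra.
From mathcomp Require Import all_classical all_reals all_analysis.

Set Implicit Arguments.
Unset Strict Implicit.
Unset Printing Implicit Defensive.

Import Order.TTheory GRing.Theory Num.Theory.

Local Open Scope classical_set_scope.
Local Open Scope ring_scope.

Definition common_subseq (A : eqType) (s t : nat) (x : 'I_s -> A)
    (y : 'I_t -> A) (k : nat) : bool :=
  [exists i : {ffun 'I_k -> 'I_s}, exists j : {ffun 'I_k -> 'I_t},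
    [&& [forall a : 'I_k, forall b : 'I_k, (a < b)%N ==> (i a < i b)%N],
        [forall a : 'I_k, forall b : 'I_k, (a < b)%N ==> (j a < j b)%N]
      & [forall a : 'I_k, x (i a) == y (j a)]]].

(* The bound k <= s loses nothing, since i_1 < ... < i_k are indices in 'I_s. *)
Definition LCS (A : eqType) (s t : nat) (x : 'I_s -> A) (y : 'I_t -> A) : nat :=
  \max_(k < s.+1 | common_subseq x y k) k.

Definition mutually_independent (d d' : measure_display) (T : measurableType d)
    (E : measurableType d') (R : realType) (P : probability T R) (I : finType)
    (Z : I -> {RV P >-> E}) : Prop :=
  forall (J : {set I}) (A : I -> set E), (forall i, measurable (A i)) ->
    P (\bigcap_(i in [set` J]) (Z i @^-1` A i)) =
    (\prod_(i in J) P (Z i @^-1` A i))%E.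

Definition identically_distributed (d d' : measure_display)
    (T : measurableType d) (E : measurableType d') (R : realType)
    (P : probability T R) (I : Type) (Z : I -> {RV P >-> E}) : Prop :=
  forall (i j : I) (A : set E), measurable A ->
    distribution P (Z i) A = distribution P (Z j) A.

(* I is finite and nat is discrete, so that every set A of vectors I -> nat is
   countable, hence measurable for the product sigma-algebra: the first conjunct
   says that the vectors Z' and Z have the same law, the second that they are
   independent. *)
Definition independent_copy (d : measure_display) (T : measurableType d)
    (R : realType) (P : probability T R) (I : finType)
    (Z Z' : I -> {RV P >-> nat}) : Prop :=
  (forall A : set (I -> nat),
     P [set w | A (fun i => Z' i w)] = P [set w | A (fun i => Z i w)]) /\
  (forall A A' : set (I -> nat),
     P [set w | A (fun i => Z i w) /\ A' (fun i => Z' i w)] =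
     (P [set w | A (fun i => Z i w)] * P [set w | A' (fun i => Z' i w)])%E).

(* S^alpha *)
Definition resample (T E : Type) (R : realType) (N : nat)
    (S : ('I_N -> E) -> R) (Z Z' : 'I_N -> T -> E) (alpha : {set 'I_N}) : T -> R :=
  fun w => S (fun k => if k \in alpha then Z' k w else Z k w).

(* {i_1, ..., i_k} *)
Definition first_indices (N : nat) (i : 'S_N) (k : nat) : {set 'I_N} :=
  [set i j | j : 'I_N & (j < k)%N]%SET.

(* The index k is 1-based: 1 <= k <= N. *)
Definition B (d : measure_display) (T : measurableType d) (E : Type)
    (R : realType) (P : probability T R) (N : nat)
    (S : ('I_N -> E) -> R) (Z Z' : 'I_N -> T -> E) (k : nat) : \bar R :=
  ('E_P[(fun w => (N`!)%:R^-1 * \sum_(i : 'S_N)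
    (S (fun j => Z j w) *
     (resample S Z Z' (first_indices i k.-1) w -
      resample S Z Z' (first_indices i k) w)))%R])%E.

Definition concat (V : Type) (n : nat) (X Y : 'I_n -> V) : 'I_(n + n) -> V :=
  fun k => match fintype.split k with inl i => X i | inr j => Y j end.

(* LC_n as a function of the 2n letters (x_1, ..., x_n, y_1, ..., y_n) *)
Definition LC (R : realType) (n : nat) (z : 'I_(n + n) -> nat) : R :=
  (LCS (fun i => z (lshift n i)) (fun j => z (rshift n j)))%:R.

(* Main.v *)
Require Import Defs.
From mathcomp Require Import all_boot all_order all_fingroup all_algebra.
From mathcomp Require Import all_classical all_reals all_analysis.
From mathcomp Require Import measurable_realfun.
From mathcomp Require Import ring lra zify.

Set Implicit Arguments.
Unset Strict Implicit.
Unset Printing Implicit Defensive.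

Import Order.TTheory GRing.Theory Num.Theory.

Local Open Scope classical_set_scope.
Local Open Scope ring_scope.

(* Averaging over a set s of coordinates is an orthogonal projection E_s, and
   E_s E_t = E_(s U t).  Write I for the set of all coordinates.  Then B_N is the
   mean over i of <f, E_(I \ i) f> - <f, E_I f> = Var E[S | Z_i] >= 0, so that
   B_N = 0 kills the first-order part of the Hoeffding decomposition of S.  The
   remaining parts have order at least 2 and are counted at least twice in the
   Efron-Stein sum, hence Var S <= 1/2 sum_i E Var(S | Z_k, k != i).  Changing
   one letter moves LC_n by at most 1, and does so only if the copy of the letter
   differs from it, so each of the 2n terms is at most (1 - sum_k p_k^2) / 2.
   For uniform letters, transposing two letters of the alphabet preserves both
   the law and LC_n, so E[LC_n | Z_i] does not depend on Z_i. *)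

(** * Averaging operators on a finite product space *)

Section product_space.

Import mathcomp.boot.finset.
Local Open Scope set_scope.
Local Open Scope ring_scope.

Variables (R : realFieldType) (I A : finType) (q : A -> R).

Implicit Types (x y : {ffun I -> A}) (f g : {ffun I -> A} -> R).
Implicit Types (s t : {set I}).

Definition weight x : R := \prod_i q (x i).

Definition merge s x y : {ffun I -> A} :=
  [ffun k => if k \in s then y k else x k].

(* Given independent letters of law q and their copies, corr f s is the paper's
   E[S S^alpha] for alpha = s, and average s f is E[S^s] conditioned on the
   original letters. *)
Definition average s f x : R := \sum_y weight y * f (merge s x y).

Definition dot f g : R := \sum_x weight x * (f x * g x).

Definition corr f s : R := dot f (average s f).

Lemma mergeK s x y : merge s (merge s x y) (merge s y x) = x.
Proof. by apply/ffunP => k; rewrite !ffunE; case: (k \in s). Qed.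

(* Exchanging x and y on s is a weight-preserving involution. *)
Lemma sum_swap s (F : {ffun I -> A} -> {ffun I -> A} -> R) :
  \sum_x \sum_y weight x * weight y * F x y =
  \sum_x \sum_y weight x * weight y * F (merge s x y) (merge s y x).
Proof.
pose h (u : {ffun I -> A} * {ffun I -> A}) :=
  (merge s u.1 u.2, merge s u.2 u.1).
have hK : involutive h by move=> [x y]; rewrite /h /= !mergeK.
rewrite !pair_bigA (reindex_inj (inv_inj hK)); apply: eq_bigr => -[x y] _ /=.
congr (_ * _); rewrite /weight -!big_split; apply: eq_bigr => k _ /=.
by rewrite !ffunE; case: ifP => // _; rewrite mulrC.
Qed.

Lemma dotE f g s : dot f (average s g) =
  \sum_x \sum_y weight x * weight y * (f x * g (merge s x y)).
Proof.
apply: eq_bigr => x _; rewrite /average !mulr_sumr; apply: eq_bigr => y _.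
by ring.
Qed.

Lemma sum_weight_prod (F : I -> A -> R) :
  \sum_x weight x * \prod_i F i (x i) = \prod_i \sum_a q a * F i a.
Proof.
by rewrite bigA_distr_bigA; apply: eq_bigr => x _; rewrite -big_split.
Qed.

Lemma merge0 x y : merge set0 x y = x.
Proof. by apply/ffunP => k; rewrite ffunE inE. Qed.

Lemma mergeT x y : merge setT x y = y.
Proof. by apply/ffunP => k; rewrite ffunE inE. Qed.

Hypothesis q1 : \sum_a q a = 1.

Lemma sum_weight : \sum_x weight x = 1.
Proof.
transitivity (\prod_(i : I) \sum_a q a); first by rewrite bigA_distr_bigA.
by rewrite big1.
Qed.

(** Product formula with factor [F] at [i] and 1 elsewhere; the other coordinates integrate to 1. *)
Lemma sum_marginal i (F : A -> R) :
  \sum_x weight x * F (x i) = \sum_a q a * F a.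
Proof.
have := sum_weight_prod (fun j a => if j == i then F a else 1).
rewrite (bigD1 i) //= eqxx [X in _ * X]big1 ?mulr1 =>
  [<-|j /negPf ->]; last first.
  by under eq_bigr do rewrite mulr1.
apply: eq_bigr => x _; rewrite (bigD1 i) //= eqxx big1 ?mulr1 // => j.
by move=> /negPf ->.
Qed.

(** Swapping [y] and [z] on [t] leaves the single sample [y] on the whole union, and [z] then
    integrates to 1. *)
Lemma average_average s t f x :
  average s (average t f) x = average (s :|: t) f x.
Proof.
transitivity (\sum_y \sum_z weight y * weight z * f (merge t (merge s x y) z)).
  apply: eq_bigr => y _; rewrite mulr_sumr; apply: eq_bigr => z _.
  by rewrite mulrA.
rewrite (sum_swap t); apply: eq_bigr => y _.
transitivity (\sum_z weight z * (weight y * f (merge (s :|: t) x y))).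
  apply: eq_bigr => z _; rewrite [_ y * _ z]mulrC -mulrA; congr (_ * (_ * f _)).
  apply/ffunP => k; rewrite !ffunE !inE.
  by case: (k \in t); case: (k \in s).
by rewrite -mulr_suml sum_weight mul1r.
Qed.

(** Swapping [x] and [y] on [s] turns [merge s x y] back into [x], which moves the average from [f]
    to [g]. *)
Lemma dot_average s f g : dot (average s f) g = dot f (average s g).
Proof.
transitivity (\sum_x \sum_y weight x * weight y * (f (merge s x y) * g x)).
  apply: eq_bigr => x _; rewrite mulr_suml mulr_sumr; apply: eq_bigr => y _.
  by ring.
rewrite (sum_swap s) dotE; apply: eq_bigr => x _; apply: eq_bigr => y _.
by rewrite mergeK.
Qed.

Lemma average0 f x : average set0 f x = f x.
Proof.
rewrite -[RHS]mul1r -sum_weight mulr_suml; apply: eq_bigr => y _.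
by rewrite merge0.
Qed.

Lemma eq_dot f1 f2 g1 g2 : f1 =1 f2 -> g1 =1 g2 -> dot f1 g1 = dot f2 g2.
Proof. by move=> ef eg; apply: eq_bigr => x _; rewrite ef eg. Qed.

Lemma dot_average_average s t f :
  dot (average s f) (average t f) = corr f (s :|: t).
Proof.
by rewrite dot_average; apply: eq_dot => // x; rewrite average_average.
Qed.

Lemma corr0 f : corr f set0 = dot f f.
Proof. by apply: eq_dot => // x; rewrite average0. Qed.

Lemma corrT f : corr f setT = (\sum_x weight x * f x) ^+ 2.
Proof.
rewrite expr2 mulr_suml; apply: eq_bigr => x _; rewrite mulrA; congr (_ * _).
by apply: eq_bigr => y _; rewrite mergeT.
Qed.

Lemma corr_average s t f : corr (average t f) s = corr f (t :|: s).
Proof.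
transitivity (dot (average t f) (average (s :|: t) f)).
  by apply: eq_dot => // x; rewrite average_average.
by rewrite dot_average_average setUCA setUid setUC.
Qed.

Definition residual t f x : R := f x - average t f x.

(** Residuals on [t] are orthogonal to averages over [t], so the cross terms cancel. Increments of
    [corr f] thus become values of [corr] for another function, which drives the inductions on
    coordinates. *)
Lemma corr_residual s t f :
  corr (residual t f) s = corr f s - corr f (t :|: s).
Proof.
transitivity (dot (residual t f)
  (fun x => average s f x - average (t :|: s) f x)).
  apply: eq_dot => // x; rewrite setUC -average_average /average -sumrB.
  by apply: eq_bigr => y _; rewrite -mulrBr.
transitivity (dot f (average s f) - dot f (average (t :|: s) f)
  - (dot (average t f) (average s f) - dot (average t f) (average (t :|: s) f))).
  by rewrite /dot -!sumrB; apply: eq_bigr => x _; rewrite /residual; ring.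
by rewrite !dot_average_average setUA setUid subrr subr0.
Qed.

(** * Positivity and variance inequalities *)

Hypothesis q0 : forall a, 0 <= q a.

Lemma weight_ge0 x : 0 <= weight x.
Proof. exact: prodr_ge0. Qed.

(** Since [average s] is self-adjoint and idempotent, this is the squared norm of [average s f]. *)
Lemma corr_ge0 f s : 0 <= corr f s.
Proof.
rewrite -[s]setUid -dot_average_average; apply: sumr_ge0 => x _.
by rewrite mulr_ge0 ?weight_ge0 // -expr2 sqr_ge0.
Qed.

Lemma corr_le0 f s : corr f s <= corr f set0.
Proof.
by have := corr_ge0 (residual s f) set0; rewrite corr_residual setU0 subr_ge0.
Qed.

Lemma corr_mono f s t : corr f (t :|: s) <= corr f s.
Proof. by rewrite -subr_ge0 -corr_residual corr_ge0. Qed.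

(** Adding [k] to the averaged set lowers [corr f] by [corr (residual [set k] f) [set i in r]],
    which is at most its value at the empty set. *)
Lemma efron_stein f (r : seq I) :
  corr f set0 - corr f [set i in r] <=
  \sum_(i <- r) (corr f set0 - corr f [set i]).
Proof.
elim: r => [|k r IHr]; first by rewrite set_nil subrr big_nil.
rewrite set_cons big_cons; have := corr_le0 (residual [set k] f) [set i in r].
by rewrite !corr_residual setU0; lra.
Qed.

(* For a function of pure Hoeffding order j this reads
   2 * [j >= 1] <= j + [j = 1].  To add the coordinate k, split f into its
   average over k, to which the induction hypothesis applies, and the residual,
   to which the Efron-Stein inequality applies. *)
Lemma efron_stein2 f (r : seq I) : uniq r ->
  2 * (corr f set0 - corr f [set i in r]) <=
  \sum_(i <- r) (corr f set0 - corr f [set i]) +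
  \sum_(i <- r) (corr f ([set j in r] :\ i) - corr f [set j in r]).
Proof.
elim: r f => [|k r IHr] f /=; first by rewrite set_nil subrr !big_nil; lra.
case/andP => kr /IHr{IHr} IHr.
have := IHr (average [set k] f).
rewrite !corr_average setU0.
under [X in _ <= X + _]eq_bigr do rewrite corr_average.
rewrite [X in _ <= _ + X](_ : _ = \sum_(i <- r)
  (corr f ((k |: [set j in r]) :\ i) - corr f (k |: [set j in r]))); last first.
  apply: eq_big_seq => i ir; rewrite corr_average; congr (corr f _ - _).
  apply/setP => j; rewrite !inE; case: (eqVneq j k) => //= ->.
  by rewrite eq_sym (memPn kr).
have := efron_stein (residual [set k] f) r.
rewrite !corr_residual setU0.
under [X in _ <= X]eq_bigr do rewrite corr_residual.
rewrite set_cons !big_cons setU1K ?inE // !sumrB.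
move: (corr_mono f [set i in r] [set k]).
lra.
Qed.

(** The assumption says that there is no first-order part: it kills the second sum of
    [efron_stein2]. *)
Lemma variance_le f :
  (forall i, corr f (setT :\ i) = corr f setT) ->
  2 * (corr f set0 - corr f setT) <= \sum_i (corr f set0 - corr f [set i]).
Proof.
move=> fi; have := efron_stein2 f (index_enum_uniq I).
have -> : [set i in index_enum I] = setT.
  by apply/setP => i; rewrite !inE mem_index_enum.
by rewrite [X in _ <= _ + X]big1 ?addr0 // => i _; rewrite fi subrr.
Qed.

(** The left side is half the mean square of the increment of [f] when letter [i] is resampled. This
    increment is at most 1 in absolute value and is 0 when the copy equals the letter. *)
Lemma corr_set1_le f i :
  (forall x a, `|f x - f [ffun k => if k == i then a else x k]| <= 1) ->
  corr f set0 - corr f [set i] <= (1 - \sum_a q a ^+ 2) / 2.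
Proof.
move=> lip; rewrite ler_pdivlMr // mulr_natr.
pose D x y : R := (x i != y i)%:R.
have -> : (corr f set0 - corr f [set i]) *+ 2 =
    \sum_x \sum_y weight x * weight y * (f x - f (merge [set i] x y)) ^+ 2.
  have E : dot f f = \sum_x \sum_y weight x * weight y * f x ^+ 2.
    apply: eq_bigr => x _; rewrite -expr2 -[LHS]mul1r -sum_weight mulr_suml.
    by apply: eq_bigr => y _; ring.
  (* One of the two terms [dot f f] becomes the mean of [f (merge [set i] x y) ^+ 2], which
     completes the square. *)
  rewrite mulr2n corr0 {1}E {1}E [X in X - _ + _](sum_swap [set i]).
  rewrite /corr dotE -!sumrB -big_split; apply: eq_bigr => x _ /=.
  rewrite -!sumrB -big_split; apply: eq_bigr => y _ /=; ring.
(* Given [x], the copy of letter [i] equals [x i] with probability [q (x i)]. *)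
have DE : \sum_x \sum_y weight x * weight y * (x i == y i)%:R = \sum_a q a ^+ 2.
  transitivity (\sum_x weight x * q (x i)); last first.
    by rewrite sum_marginal; apply: eq_bigr => a _; rewrite expr2.
  apply: eq_bigr => x _.
  rewrite -[RHS](_ : weight x * (\sum_y weight y * (x i == y i)%:R) = _).
    by rewrite mulr_sumr; apply: eq_bigr => y _; rewrite mulrA.
  rewrite (sum_marginal i (fun a => (x i == a)%:R)) (bigD1 (x i)) //= eqxx.
  by rewrite big1 ?addr0 ?mulr1 // => a; rewrite eq_sym => /negPf ->;
    rewrite mulr0.
apply: (@le_trans _ _ (\sum_x \sum_y weight x * weight y * (1 - (x i == y i)%:R))).
  apply: ler_sum => x _; apply: ler_sum => y _; apply: ler_wpM2l.
    by rewrite mulr_ge0 ?weight_ge0.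
  have -> : merge [set i] x y = [ffun k => if k == i then y i else x k].
    by apply/ffunP => k; rewrite !ffunE inE; case: eqP => // ->.
  case: eqP => [exy|_].
    have -> : [ffun k => if k == i then y i else x k] = x.
      by apply/ffunP => k; rewrite ffunE; case: eqP => // ->.
    by rewrite !subrr expr0n.
  rewrite subr0 -real_normK ?num_real //.
  by rewrite expr_le1 ?lip.
have E1 : 1 = \sum_x \sum_y weight x * weight y.
  rewrite -[LHS]sum_weight; apply: eq_bigr => x _.
  by rewrite -mulr_sumr sum_weight mulr1.
rewrite -DE [X in _ <= X - _]E1 -sumrB; apply: ler_sum => x _; rewrite -sumrB.
by apply: ler_sum => y _; rewrite mulrBr mulr1.
Qed.

(** A symmetry [s] carrying [x i] to [y i] shows that the conditional mean of [f] given letter [i]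
    is constant. It is asked only between letters of nonzero mass, as the alphabet used later
    contains a letter of mass 0. *)
Lemma corr_setD1_sym f i :
  (forall a b, q a != 0 -> q b != 0 -> exists s : {perm A},
    [/\ s a = b, forall c, q (s c) = q c
      & forall x, f [ffun k => s (x k)] = f x]) ->
  corr f (setT :\ i) = corr f setT.
Proof.
move=> sym; apply: eq_bigr => x _.
have [->|wx] := eqVneq (weight x) 0; first by rewrite !mul0r.
have weight_neq0 y : weight y != 0 -> q (y i) != 0.
  by rewrite /weight (bigD1 i) //= mulf_eq0 negb_or => /andP[].
(* It remains to see that the conditional mean given letter [i] equals its own average over that
   letter. *)
rewrite -(setD1K (in_setT i)) -average_average setD1K ?inE //.
congr (_ * (_ * _)); rewrite [RHS]/average.
rewrite -[LHS]mul1r -sum_weight mulr_suml; apply: eq_bigr => y _.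
have [->|wy] := eqVneq (weight y) 0; first by rewrite !mul0r.
congr (_ * _).
have [s [sxy qs fs]] := sym _ _ (weight_neq0 x wx) (weight_neq0 y wy).
pose h x : {ffun I -> A} := [ffun k => s (x k)].
have h_inj : injective h.
  move=> z z' /ffunP e; apply/ffunP => k; apply: (@perm_inj _ s).
  by have := e k; rewrite !ffunE.
(* Relabelling the resampled letters by [s] keeps their weight. *)
rewrite /average [RHS](reindex_inj h_inj); apply: eq_bigr => z _.
congr (_ * _).
  by apply: eq_bigr => k _; rewrite ffunE qs.
rewrite -fs; congr f; apply/ffunP => k; rewrite !ffunE !inE.
by case: eqP => //= ->.
Qed.

End product_space.

(** * Stability of the longest common subsequence *)

Section LCS_theory.
Variables (A A' : eqType) (s t : nat).

(** Skipping position [a0] with the increasing map [lift a0] keeps both index sequences increasing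
    and drops the one pair that may fail to match. *)
Lemma common_subseq_drop (x : 'I_s -> A) (y : 'I_t -> A) k
    (i : {ffun 'I_k.+1 -> 'I_s}) (j : {ffun 'I_k.+1 -> 'I_t}) (a0 : 'I_k.+1) :
  (forall a b : 'I_k.+1, (a < b)%N -> (i a < i b)%N) ->
  (forall a b : 'I_k.+1, (a < b)%N -> (j a < j b)%N) ->
  (forall a, a != a0 -> x (i a) = y (j a)) -> common_subseq x y k.
Proof.
move=> hi hj hxy.
have lift_lt (a b : 'I_k) : (a < b)%N -> (lift a0 a < lift a0 b)%N.
  by rewrite /= /bump => ab; lia.
apply/existsP; exists [ffun a => i (lift a0 a)].
apply/existsP; exists [ffun a => j (lift a0 a)].
apply/and3P; split.
- apply/forallP => a; apply/forallP => b; apply/implyP => ab; rewrite !ffunE.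
  exact/hi/lift_lt.
- apply/forallP => a; apply/forallP => b; apply/implyP => ab; rewrite !ffunE.
  exact/hj/lift_lt.
- by apply/forallP => a; rewrite !ffunE hxy // eq_sym neq_lift.
Qed.

(* When one letter is changed, at most one pair of a matching is spoiled. *)
Lemma LCS_leS (x x' : 'I_s -> A) (y y' : 'I_t -> A) :
  (forall i1 i2 j1 j2, i1 != i2 -> j1 != j2 -> x i1 = y j1 -> x i2 = y j2 ->
     x' i1 = y' j1 \/ x' i2 = y' j2) ->
  (LCS x y <= (LCS x' y').+1)%N.
Proof.
move=> hch; apply/bigmax_leqP => -[[|k] ks] //= /existsP[i /existsP[j]].
case/and3P => /forallP hi /forallP hj /forallP hxy.
have {}hi (a b : 'I_k.+1) : (a < b)%N -> (i a < i b)%N.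
  by move=> ab; have /forallP/(_ b)/implyP/(_ ab) := hi a.
have {}hj (a b : 'I_k.+1) : (a < b)%N -> (j a < j b)%N.
  by move=> ab; have /forallP/(_ b)/implyP/(_ ab) := hj a.
have neq (u : nat) (h : {ffun 'I_k.+1 -> 'I_u}) :
    (forall a b : 'I_k.+1, (a < b)%N -> (h a < h b)%N) ->
    forall a b, a != b -> h a != h b.
  move=> hlt a b; rewrite neq_ltn => /orP[] /hlt; rewrite -val_eqE /=; lia.
(* [a0] is the spoiled pair if there is one, and the first pair otherwise. *)
have [a0 ha0] : exists a0, forall a, a != a0 -> x' (i a) = y' (j a).
  have [a0 bad|good] := pickP (fun a => x' (i a) != y' (j a)); last first.
    by exists ord0 => a _; apply/eqP; have := good a => /negbFE.
  exists a0 => a aa0.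
  have [//|e] := hch _ _ _ _ (neq _ _ hi _ _ aa0) (neq _ _ hj _ _ aa0)
    (eqP (hxy a)) (eqP (hxy a0)).
  by rewrite e eqxx in bad.
rewrite ltnS; apply: (@leq_bigmax_cond _ _ _ (Ordinal (ltnW ks))).
exact: common_subseq_drop hi hj ha0.
Qed.

(** Matchings depend only on which letters are equal. *)
Lemma LCS_inj (g : A -> A') (x : 'I_s -> A) (y : 'I_t -> A) :
  injective g -> LCS (g \o x) (g \o y) = LCS x y.
Proof.
move=> gi; apply: eq_bigl => k; apply: eq_existsb => i; apply: eq_existsb => j.
by congr [&& _, _ & _]; apply: eq_forallb => a; rewrite /= inj_eq.
Qed.

End LCS_theory.

(** * From expectations to finite weighted sums *)

Section probability_on_countable_types.
Variables (d : measure_display) (T : measurableType d) (R : realType).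
Variable P : probability T R.

Lemma measurable_preimage_countable (U : countType) (h : T -> U) (A : set U) :
  (forall u, measurable (h @^-1` [set u])) -> measurable (h @^-1` A).
Proof.
move=> mh; rewrite (_ : _ @^-1` _ = 
  \bigcup_u (if u \in A then h @^-1` [set u] else set0)).
  by apply: countable_bigcupT_measurable => // u; case: ifP.
apply/seteqP; split => [w Ahw|w [u _]] /=.
  by exists (h w) => //; rewrite mem_set.
by case: ifPn => // /set_mem Au /= ->.
Qed.

Lemma measurable_comp_countable (U : countType) (h : T -> U) (g : U -> R) :
  (forall u, measurable (h @^-1` [set u])) -> measurable_fun setT (g \o h).
Proof.
move=> mh _ B mB; rewrite setTI comp_preimage.
exact: measurable_preimage_countable.
Qed.

Lemma expectation_finite (U : finType) (h : T -> U) (g : U -> R) :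
  (forall u, measurable (h @^-1` [set u])) ->
  'E_P[g \o h]%E = (\sum_u g u * fine (P (h @^-1` [set u])))%:E.
Proof.
move=> mh; rewrite unlock.
transitivity (\int[P]_w \sum_u ((g u)%:E * (\1_(h @^-1` [set u]) w)%:E))%E.
  apply: eq_integral => w _ /=; rewrite (bigD1 (h w)) //= indicE mem_set //=.
  rewrite mule1 big1 ?adde0 // => u /eqP hu.
  by rewrite indicE memNset ?mule0 //= => /esym.
have iI u : P.-integrable setT (fun w => (\1_(h @^-1` [set u]) w)%:E).
  exact: integrable_indic.
rewrite integral_sum //; last by move=> u; exact: integrableZl.
rewrite -sumEFin; apply: eq_bigr => u _.
by rewrite integralZl // integral_indic // setIT EFinM fineK // fin_num_measure.
Qed.

Lemma measurable_ffun_fiber (I : finType) (Z : I -> {RV P >-> nat})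
    (x : {ffun I -> nat}) :
  measurable ((fun w => [ffun k => Z k w]) @^-1` [set x]).
Proof.
rewrite (_ : _ @^-1` _ = \bigcap_(k in setT) (Z k @^-1` [set x k])).
  apply: fin_bigcap_measurable => // k _.
  by rewrite -[X in measurable X]setTI; exact: measurable_funP.
apply/seteqP; split => w /=.
  by move=> /ffunP e k _ /=; rewrite -e ffunE.
by move=> e; apply/ffunP => k; rewrite ffunE; exact: e.
Qed.

(** The vector is read in the countable type [{ffun I -> nat}], where every set is a countable union
    of points. *)
Lemma measurable_event (I : finType) (Z : I -> {RV P >-> nat})
    (A : set (I -> nat)) : measurable [set w | A (fun k => Z k w)].
Proof.
pose h w : {ffun I -> nat} := [ffun k => Z k w].
have hE w : (fun k => h w k) = (fun k => Z k w).
  by apply/funext => k; rewrite ffunE.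
rewrite (_ : [set _ | _] = h @^-1` [set x | A (fun k => x k)]).
  by apply: measurable_preimage_countable => x; exact: measurable_ffun_fiber.
by apply/seteqP; split => w /=; rewrite hE.
Qed.

(** Transfers the probabilistic statement to the finite product space: the pair of vectors has the
    product law with density [weight q x * weight q y]. *)
Lemma expectation_copy (I : finType) (m : nat) (Z Z' : I -> {RV P >-> nat})
    (q : 'I_m.+1 -> R) (G : (I -> nat) -> (I -> nat) -> R) :
  (forall i w, (Z i w <= m)%N) ->
  mutually_independent Z ->
  (forall i a, P [set w | inord (Z i w) = a] = (q a)%:E) ->
  independent_copy Z Z' ->
  'E_P[fun w => G (fun k => Z k w) (fun k => Z' k w)]%E =
  (\sum_(x : {ffun I -> 'I_m.+1}) \sum_(y : {ffun I -> 'I_m.+1})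
     weight q x * weight q y * G (fun k => x k) (fun k => y k))%:E.
Proof.
move=> Zm Zi Zq [Zlaw Zcopy].
pose c (z : I -> nat) : {ffun I -> 'I_m.+1} := [ffun k => inord (z k)].
pose h w := (c (fun k => Z k w), c (fun k => Z' k w)).
pose g (u : {ffun I -> 'I_m.+1} * {ffun I -> 'I_m.+1}) :=
  G (fun k => u.1 k) (fun k => u.2 k).
have mh u : measurable (h @^-1` [set u]).
  rewrite (_ : _ @^-1` _ = [set w | (c @^-1` [set u.1]) (fun k => Z k w)] `&`
    [set w | (c @^-1` [set u.2]) (fun k => Z' k w)]).
    by apply: measurableI; exact: measurable_event.
  by case: u => u1 u2; apply/seteqP; split => w /= [<- <-].
(* Independence is used with all indices at once. *)
have Pc x : P [set w | c (fun k => Z k w) = x] = (weight q x)%:E.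
  have := Zi [set: I]%SET (fun i => [set k | inord k = x i]) (fun=> Logic.I).
  rewrite (_ : \bigcap_(i in _) _ = [set w | c (fun k => Z k w) = x]); last first.
    apply/seteqP; split => w /=.
      by move=> e; apply/ffunP => k; rewrite ffunE; apply: e; rewrite /= inE.
    by move=> /ffunP e k _ /=; rewrite -e ffunE.
  move=> ->; rewrite /weight -prodEFin; apply: eq_big => [i|i _].
    by rewrite inE.
  exact: Zq.
(* Encoding by [inord] is exact for [Z], but for [Z'] only almost surely: its bound by [m] comes
   from equality of laws. *)
have -> : 'E_P[fun w => G (fun k => Z k w) (fun k => Z' k w)]%E = 'E_P[g \o h]%E.
  rewrite unlock; apply: ae_eq_integral => //.
  - apply/measurable_EFinP.
    pose h' w := ([ffun k => Z k w], [ffun k => Z' k w]).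
    pose g' (u : {ffun I -> nat} * {ffun I -> nat}) := G u.1 u.2.
    rewrite (_ : (fun _ => _) = g' \o h'); last first.
      by apply/funext => w; congr G; apply/funext => k; rewrite ffunE.
    apply: measurable_comp_countable => -[u1 u2].
    rewrite (_ : _ @^-1` _ = ((fun w => [ffun k => Z k w]) @^-1` [set u1]) `&`
      ((fun w => [ffun k => Z' k w]) @^-1` [set u2])).
      by apply: measurableI; exact: measurable_ffun_fiber.
    by apply/seteqP; split => w /= [<- <-].
  - exact/measurable_EFinP/measurable_comp_countable.
  - pose N : set (I -> nat) := [set z | ~ forall k, (z k <= m)%N].
    have N0 : P [set w | N (fun k => Z' k w)] = 0%E.
      rewrite (Zlaw N) [X in P X](_ : _ = set0) ?measure0 //.
      by apply/seteqP; split => // w; apply => k; exact: Zm.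
    exists [set w | N (fun k => Z' k w)].
    split; [exact: measurable_event|exact: N0|].
    apply: subsetCl => w /contrapT Z'm _ /=; congr (G _ _)%:E.
      by apply/funext => k; rewrite ffunE inordK // ltnS.
    by apply/funext => k; rewrite ffunE inordK // ltnS.
rewrite expectation_finite // pair_bigA; congr (_%:E); apply: eq_bigr => -[x y] _.
rewrite [LHS]mulrC; congr (_ * _) => /=.
rewrite [X in P X](_ : _ = [set w | (c @^-1` [set x]) (fun k => Z k w) /\
  (c @^-1` [set y]) (fun k => Z' k w)]); last first.
  by apply/seteqP; split => w /= [<- <-].
by rewrite Zcopy Zlaw [X in (X * _)%E]Pc [X in (_ * X)%E]Pc.
Qed.

End probability_on_countable_types.

(** * Variance and the terms [B] in terms of [corr] *)

Section resampling.
Variables (d : measure_display) (T : measurableType d) (R : realType).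
Variables (P : probability T R) (N m : nat).
Variables (Z Z' : 'I_N -> {RV P >-> nat}) (q : 'I_m.+1 -> R).
Variable S : ('I_N -> nat) -> R.
Hypothesis Zm : forall i w, (Z i w <= m)%N.
Hypothesis Zindep : mutually_independent Z.
Hypothesis Zq : forall i a, P [set w | inord (Z i w) = a] = (q a)%:E.
Hypothesis Zcopy : independent_copy Z Z'.
Hypothesis q1 : \sum_a q a = 1.

Let f (x : {ffun 'I_N -> 'I_m.+1}) : R := S (fun k => x k).

Lemma expectation_single (G : ('I_N -> nat) -> R) :
  'E_P[fun w => G (fun k => Z k w)]%E =
  (\sum_(x : {ffun 'I_N -> 'I_m.+1}) weight q x * G (fun k => x k))%:E.
Proof.
rewrite (expectation_copy (fun z _ => G z) Zm Zindep Zq Zcopy).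
congr (_%:E); apply: eq_bigr => x _.
by rewrite -mulr_suml -mulr_sumr sum_weight ?mulr1.
Qed.

(** The two terms are the second moment and the squared mean. *)
Lemma variance_corr : 'V_P[fun w => S (fun k => Z k w)]%E =
  (corr q f finset.set0 - corr q f [set: 'I_N]%SET)%:E.
Proof.
rewrite /variance unlock expectation_single /=.
set c := \sum_x _; have cE : \sum_x weight q x * f x = c by [].
 rewrite [in LHS]/GRing.mul /=.
rewrite (expectation_single (fun z => (S z - c) * (S z - c))); congr (_%:E).
clearbody c; rewrite corr0 // corrT /dot -/c.
transitivity (\sum_x (weight q x * (f x * f x)) -
    2 * c * \sum_x (weight q x * f x) +
    c ^+ 2 * \sum_(x : {ffun 'I_N -> 'I_m.+1}) weight q x).
  rewrite !mulr_sumr -sumrB -big_split; apply: eq_bigr => x _ /=.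
  by rewrite -/(f x); ring.
by rewrite cE sum_weight //; ring.
Qed.

Lemma B_corr k : B P S Z Z' k =
  ((N`!)%:R^-1 * \sum_(i : 'S_N)
    (corr q f (first_indices i k.-1) - corr q f (first_indices i k)))%:E.
Proof.
pose G (z z' : 'I_N -> nat) : R := (N`!)%:R^-1 * \sum_(i : 'S_N) (S z *
  (S (fun j => if j \in first_indices i k.-1 then z' j else z j) -
   S (fun j => if j \in first_indices i k then z' j else z j))).
rewrite [LHS](expectation_copy G Zm Zindep Zq Zcopy); congr (_%:E).
(* Resampling on [s] is [merge s] on encoded vectors. *)
have fE (s : {set 'I_N}) (x y : {ffun 'I_N -> 'I_m.+1}) :
      S (fun j => if j \in s then val (y j) else val (x j)) = f (merge s x y).
  by rewrite /f; congr S; apply/funext => j; rewrite ffunE; case: ifP.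
rewrite mulr_sumr; under [RHS]eq_bigr do rewrite /corr !dotE -sumrB mulr_sumr.
rewrite [RHS]exchange_big; apply: eq_bigr => x _.
under [RHS]eq_bigr do rewrite -sumrB mulr_sumr.
rewrite [RHS]exchange_big; apply: eq_bigr => y _.
rewrite /G !mulr_sumr.
by apply: eq_bigr => i _; rewrite !fE -/(f x); ring.
Qed.

End resampling.

(** * The last term of the sequence *)

Lemma first_indices_all N (i : 'S_N) : first_indices i N = [set: 'I_N]%SET.
Proof.
apply/setP => k; rewrite inE; apply/imsetP; exists ((i^-1)%g k).
  by rewrite inE ltn_ord.
by rewrite permKV.
Qed.

Lemma first_indices_pred N (i : 'S_N.+1) :
  first_indices i N = ([set: 'I_N.+1] :\ i ord_max)%SET.
Proof.
apply/setP => k; rewrite !inE andbT; apply/imsetP/idP => [[j]|ki].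
  by rewrite inE => jN ->; rewrite (inj_eq perm_inj) -val_eqE /= ltn_eqF.
exists ((i^-1)%g k); last by rewrite permKV.
rewrite inE ltn_neqAle -ltnS ltn_ord andbT.
apply: contra ki => /eqP e; rewrite -[k](permKV i); apply/eqP; congr (i _).
exact: val_inj.
Qed.

(** The last term is a mean over permutations of nonnegative differences, so it vanishes exactly
    when each difference does; every index comes last in some permutation. *)
Lemma B_last_eq0 (d : measure_display) (T : measurableType d) (R : realType)
    (P : probability T R) (N m : nat) (Z Z' : 'I_N -> {RV P >-> nat})
    (q : 'I_m.+1 -> R) (S : ('I_N -> nat) -> R) :
  (forall i w, (Z i w <= m)%N) -> mutually_independent Z ->
  (forall i a, P [set w | inord (Z i w) = a] = (q a)%:E) ->
  independent_copy Z Z' -> \sum_a q a = 1 -> (forall a, 0 <= q a) ->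
  let f (x : {ffun 'I_N -> 'I_m.+1}) := S (fun k => x k) in
  B P S Z Z' N = 0%E <->
  forall i, corr q f ([set: 'I_N] :\ i)%SET = corr q f [set: 'I_N]%SET.
Proof.
case: N => [|N] in Z Z' S *; move=> Zm Zi Zq Zc q1 q0 f.
  rewrite (B_corr _ Zm Zi Zq Zc); split => [_ []//|_].
  by rewrite big1 ?mulr0 // => i _; rewrite subrr.
rewrite (B_corr _ Zm Zi Zq Zc) -/f.
under eq_bigr do rewrite first_indices_all first_indices_pred.
split=> [[] /eqP|fi]; last by rewrite big1 ?mulr0 // => i _; rewrite fi subrr.
rewrite mulf_eq0 invr_eq0 pnatr_eq0 -leqn0 leqNgt fact_gt0 /=.
rewrite psumr_eq0 => [/allP /= h i|i _]; last first.
  have := corr_mono q1 q0 f ([set: _] :\ i ord_max)%SET [set i ord_max]%SET.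
  by rewrite finset.setD1K ?finset.in_setT // subr_ge0.
apply/eqP; rewrite -subr_eq0.
(* This transposition puts [i] in the last place. *)
by have := h (tperm ord_max i) (mem_index_enum _); rewrite tpermL.
Qed.

(** * The variance bound and the uniform case *)

Theorem mainTheorem5 (R : realType) (d : measure_display)
    (T : measurableType d) (P : probability T R) (m n : nat)
    (hm : (1 <= m)%N) (hn : (1 <= n)%N)
    (X Y : 'I_n -> {RV P >-> nat})
    (hX : forall (i : 'I_n) (w : T), (1 <= X i w <= m)%N)
    (hY : forall (i : 'I_n) (w : T), (1 <= Y i w <= m)%N)
    (hindep : mutually_independent (concat X Y))
    (hident : identically_distributed (concat X Y))
    (p : nat -> R)
    (hp : forall k : nat, (1 <= k <= m)%N ->
       (p k)%:E = P [set w | X (Ordinal hn) w = k])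
    (Z' : 'I_(n + n) -> {RV P >-> nat})
    (hcopy : independent_copy (concat X Y) Z') :
  (B P (@LC R n) (concat X Y) Z' (n + n) = 0%E ->
   ('V_P[(fun w => (@LCS nat n n (fun i => X i w) (fun j => Y j w))%:R)%R]
      <= ((1 - \sum_(1 <= k < m.+1) p k ^+ 2) * (n%:R / 2))%R%:E)%E)
  /\
  ((forall k : nat, (1 <= k <= m)%N -> p k = 1 / m%:R) ->
   B P (@LC R n) (concat X Y) Z' (n + n) = 0%E).
Proof.
set Z := concat X Y in hindep hident hcopy *.
have Zl i : Z (lshift n i) = X i.
  by rewrite /Z /concat -[lshift n i]/(unsplit (inl i)) unsplitK.
have Zr i : Z (rshift n i) = Y i.
  by rewrite /Z /concat -[rshift n i]/(unsplit (inr i)) unsplitK.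
have Zm i w : (Z i w <= m)%N.
  rewrite /Z /concat; case: (fintype.split i) => j.
    by case/andP: (hX j w).
  by case/andP: (hY j w).
pose h w : 'I_m.+1 := inord (X (Ordinal hn) w).
pose q a : R := fine (P (h @^-1` [set a])).
have mh a : measurable (h @^-1` [set a]).
  rewrite -[X in measurable X]setTI.
  rewrite (_ : h @^-1` _ = X (Ordinal hn) @^-1` [set k | inord k = a]) //.
  exact: measurable_funP.
have q0 a : 0 <= q a by exact: fine_ge0.
have q1 : \sum_a q a = 1.
  apply: EFin_inj; rewrite -(expectation_cst P 1).
  rewrite [RHS](expectation_finite P (fun=> 1) mh); congr (_%:E).
  by apply: eq_bigr => a _; rewrite mul1r.
have Zq i a : P [set w | inord (Z i w) = a] = (q a)%:E.
  rewrite fineK ?fin_num_measure //.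
  have := hident i (lshift n (Ordinal hn)) [set k | inord k = a] Logic.I.
  by rewrite Zl.
have qp (a : 'I_m.+1) : a != ord0 -> q a = p a.
  move=> a0; have am : (1 <= a <= m)%N by rewrite lt0n a0 -ltnS ltn_ord.
  rewrite /q (_ : h @^-1` _ = [set w | X (Ordinal hn) w = a]) -?hp //.
  apply/seteqP; split => w; rewrite /h /= => e; last by rewrite e inord_val.
  by rewrite -e inordK // ltnS; case/andP: (hX (Ordinal hn) w).
(* Letters start at 1, so the extra value 0 of ['I_m.+1] has no mass. *)
have q00 : q ord0 = 0.
  rewrite /q (_ : h @^-1` _ = classical_sets.set0) ?measure0 //.
  apply/seteqP; split => // w /= /(congr1 val) /=.
  have /andP[X1 Xm] := hX (Ordinal hn) w.
  by rewrite inordK ?ltnS // => e; rewrite e in X1.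
pose f (x : {ffun 'I_(n + n) -> 'I_m.+1}) : R := LC R (fun k => x k).
have Beq := B_last_eq0 (@LC R n) Zm hindep Zq hcopy q1 q0.
split=> [/Beq fi|unif].
- have -> : (fun w => (LCS (fun i => X i w) (fun j => Y j w))%:R : R) =
      (fun w => LC R (fun k => Z k w)).
    apply/funext => w; rewrite /LC.
    have -> : (fun i => X i w) = (fun i => Z (lshift n i) w).
      by apply/funext => i; rewrite Zl.
    have -> // : (fun i => Y i w) = (fun i => Z (rshift n i) w).
    by apply/funext => i; rewrite Zr.
  rewrite (variance_corr _ Zm hindep Zq hcopy q1) lee_fin -/f.
  have -> : \sum_(1 <= k < m.+1) p k ^+ 2 = \sum_a q a ^+ 2.
    rewrite big_ord_recl q00 expr0n add0r big_add1 big_mkord.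
    by apply: eq_bigr => a _; rewrite qp.
  have := variance_le q1 q0 fi.
  have : \sum_i (corr q f finset.set0 - corr q f [set i]%SET) <=
      \sum_(i < n + n) (1 - \sum_a q a ^+ 2) / 2.
    apply: ler_sum => i _; apply: corr_set1_le => // x a.
    have lip (u v : {ffun 'I_(n + n) -> 'I_m.+1}) :
        (forall k, k != i -> u k = v k) -> f u <= f v + 1.
      move=> uv; rewrite natr1 ler_nat; apply: LCS_leS.
      move=> i1 i2 j1 j2 i12 j12 e1 e2.
      (* The changed letter lies in one of the two words. Of two pairs with distinct indices in that
         word, one avoids it and still matches. *)
      case: (split_ordP i) uv => k -> uv.
        have [e|ne] := eqVneq i1 k; [right|left].
          by rewrite -!uv ?eq_lshift ?eq_rlshift // -e eq_sym.
        by rewrite -!uv ?eq_lshift ?eq_rlshift.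
      have [e|ne] := eqVneq j1 k; [right|left].
        by rewrite -!uv ?eq_rshift ?eq_lrshift // -e eq_sym.
      by rewrite -!uv ?eq_rshift ?eq_lrshift.
    set x' := [ffun k => _].
    have xx' k : k != i -> x k = x' k by move=> /negPf ki; rewrite ffunE ki.
    rewrite ler_norml; apply/andP; split.
      by have := lip x' x (fun k ki => esym (xx' k ki)); lra.
    by have := lip x x' xx'; lra.
  (* Twice the variance is at most [n + n] times half of [1 - \sum_a q a ^+ 2]. *)
  rewrite sumr_const card_ord -[X in _ <= X -> _]mulr_natr natrD.
  lra.
- apply/Beq => i; apply: corr_setD1_sym => // a b qa qb.
  have neq0 c : q c != 0 -> c != ord0 by apply: contraNneq => ->; rewrite q00.
  have {}unif c : q c != 0 -> q c = 1 / m%:R.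
    move=> /neq0 c0; rewrite qp // unif //.
    by rewrite lt0n c0 -ltnS ltn_ord.
  (* Both letters have mass [1 / m], so their transposition preserves [q]. *)
  exists (tperm a b); split => [|c|x]; first by rewrite tpermL.
    by case: tpermP => [->|->|//]; rewrite (unif a qa) (unif b qb).
  rewrite /LC; congr (_%:R).
  pose xl i := x (lshift n i); pose xr i := x (rshift n i).
  (* Both sides are images of the same encoded words under injective maps: [val], and [val] after
     the transposition. *)
  transitivity (LCS xl xr); last exact/esym/(LCS_inj xl xr val_inj).
  have gI : injective (fun c : 'I_m.+1 => val (tperm a b c)).
    by move=> c1 c2 /val_inj /perm_inj.
  rewrite -(LCS_inj xl xr gI).
  set u := fun i => _; set v := fun i => _.
  have -> : u = (fun c => val (tperm a b c)) \o xl.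
    by apply/funext => i1; rewrite /u ffunE.
  have -> // : v = (fun c => val (tperm a b c)) \o xr.
  by apply/funext => i1; rewrite /v ffunE.
Qed.
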